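(* Let $f\colon X\to X$ be a homeomorphism of a compact metric space with the L-shadowing property. Then $f$ has the shadowing property, $f$ has only finitely many chain recurrent classes, and each chain recurrent class $\Lambda$ of $f$ either is expansive (i.e. $f|_\Lambda$ is expansive) or contains arbitrarily small topological semi-horseshoes, i.e. for every $\epsilon>0$ there exist $N\ge1$ and a compact set $K\subset\Lambda$ with $f^N(K)=K$, $\sup_{k\in\mathbb{Z}}\operatorname{diam}(f^k(K))\le\epsilon$, and $f^N|_K$ semi-conjugate to the full shift on two symbols.
   Context: $(X,d)$ compact metric space, $f\colon X\to X$ homeomorphism. A $(\delta,L)$-pseudo orbit is a sequence $(x_k)_{k\in\mathbb{Z}}$ with $d(f(x_k),x_{k+1})\le\delta$ for all $k$ and $d(f(x_k),x_{k+1})\to0$ as $|k|\to\infty$; it is $(\varepsilon,L)$-shadowed by $z$ if $d(f^k(z),x_k)\le\varepsilon$ for all $k$ and $d(f^k(z),x_k)\to0$ as $|k|\to\infty$. $f$ has the L-shadowing property if for every $\varepsilon>0$ there is $\delta>0$ such that every $(\delta,L)$-pseudo orbit is $(\varepsilon,L)$-shadowed. A $\delta$-pseudo-orbit is a sequence $(x_k)_{k\in\mathbb{Z}}$ with $d(f(x_k),x_{k+1})<\delta$ for all $k$; $f$ has the shadowing property if for every $\varepsilon>0$ there is $\delta>0$ such that for every $\delta$-pseudo-orbit there is $y$ with $d(f^k(y),x_k)<\varepsilon$ for all $k\in\mathbb{Z}$. The chain recurrent class of $x$ is the set of $y$ such that for every $\varepsilon>0$ there is a periodic $\varepsilon$-pseudo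 orbit containing both $x$ and $y$. A compact invariant set $\Lambda$ is expansive if there is $c>0$ such that for all distinct $x,y\in\Lambda$ there is $n\in\mathbb{Z}$ with $d(f^n(x),f^n(y))>c$. A map $g\colon K\to K$ is semi-conjugate to the full shift $\sigma$ on $\{0,1\}^{\mathbb{Z}}$ if there is a continuous surjection $h\colon K\to\{0,1\}^{\mathbb{Z}}$ with $h\circ g=\sigma\circ h$. *)

(* Defs.v *)
From Stdlib Require Import Reals ZArith List.
Open Scope R_scope.

Section Defs.
Context {X : Type} (d : X -> X -> R).

Definition is_metric : Prop :=
  (forall x y, 0 <= d x y) /\
  (forall x y, d x y = 0 <-> x = y) /\
  (forall x y, d x y = d y x) /\
  (forall x y z, d x z <= d x y + d y z).

Definition open_set (U : X -> Prop) : Prop :=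
  forall x, U x -> exists r, 0 < r /\ forall y, d x y < r -> U y.

Definition compact_set (K : X -> Prop) : Prop :=
  forall (I : Type) (U : I -> X -> Prop),
    (forall i, open_set (U i)) ->
    (forall x, K x -> exists i, U i x) ->
    exists l : list I, forall x, K x -> exists i, In i l /\ U i x.

Definition continuous_map (g : X -> X) : Prop :=
  forall x eps, 0 < eps -> exists delta, 0 < delta /\
    forall y, d x y < delta -> d (g x) (g y) < eps.

Definition homeomorphism (f finv : X -> X) : Prop :=
  continuous_map f /\ continuous_map finv /\
  (forall x, finv (f x) = x) /\ (forall x, f (finv x) = x).

Definition iterZ (f finv : X -> X) (k : Z) (x : X) : X :=
  match k with
  | Z0 => x
  | Zpos p => Nat.iter (Pos.to_nat p) f x
  | Zneg p => Nat.iter (Pos.to_nat p) finv x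
  end.

Definition tends_to_zero_Z (u : Z -> R) : Prop :=
  forall eps, 0 < eps -> exists N : Z, forall k, (N <= Z.abs k)%Z -> u k < eps.

Section Dyn.
Variables f finv : X -> X.

Definition deltaL_pseudo_orbit (delta : R) (xs : Z -> X) : Prop :=
  (forall k, d (f (xs k)) (xs (k + 1)%Z) <= delta) /\
  tends_to_zero_Z (fun k => d (f (xs k)) (xs (k + 1)%Z)).

Definition epsL_shadowed (eps : R) (xs : Z -> X) (z : X) : Prop :=
  (forall k, d (iterZ f finv k z) (xs k) <= eps) /\
  tends_to_zero_Z (fun k => d (iterZ f finv k z) (xs k)).

Definition L_shadowing : Prop :=
  forall eps, 0 < eps -> exists delta, 0 < delta /\
    forall xs, deltaL_pseudo_orbit delta xs -> exists z, epsL_shadowed eps xs z.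

Definition pseudo_orbit (delta : R) (xs : Z -> X) : Prop :=
  forall k, d (f (xs k)) (xs (k + 1)%Z) < delta.

Definition shadowing : Prop :=
  forall eps, 0 < eps -> exists delta, 0 < delta /\
    forall xs, pseudo_orbit delta xs ->
      exists y, forall k, d (iterZ f finv k y) (xs k) < eps.

Definition periodic_seq (xs : Z -> X) : Prop :=
  exists n : Z, (0 < n)%Z /\ forall k, xs (k + n)%Z = xs k.

Definition CR_of (x y : X) : Prop :=
  forall eps, 0 < eps -> exists xs, pseudo_orbit eps xs /\ periodic_seq xs /\
    (exists i, xs i = x) /\ (exists j, xs j = y).

Definition set_eq (A B : X -> Prop) : Prop := forall y, A y <-> B y.

Definition is_CR_class (L : X -> Prop) : Prop :=
  exists x, CR_of x x /\ set_eq L (CR_of x).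

Definition finitely_many_CR_classes : Prop :=
  exists l : list (X -> Prop), forall L, is_CR_class L -> exists M, In M l /\ set_eq L M.

Definition expansive_set (L : X -> Prop) : Prop :=
  exists c, 0 < c /\ forall x y, L x -> L y -> x <> y ->
    exists n : Z, d (iterZ f finv n x) (iterZ f finv n y) > c.

(* Continuity of h : K -> {0,1}^Z for the product topology: each coordinate
   window [-n,n] of h is locally constant on K (equivalently eps-delta
   continuity for the standard metric on the full shift). *)
Definition continuous_to_shift (K : X -> Prop) (h : X -> Z -> bool) : Prop :=
  forall x, K x -> forall n : Z, exists delta, 0 < delta /\
    forall x', K x' -> d x x' < delta ->
      forall k, (Z.abs k <= n)%Z -> h x' k = h x k.

Definition semiconj_full_shift (g : X -> X) (K : X -> Prop) : Prop :=
  exists h : X -> Z -> bool,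
    continuous_to_shift K h /\
    (forall s : Z -> bool, exists x, K x /\ forall k, h x k = s k) /\
    (forall x, K x -> forall k, h (g x) k = h x (k + 1)%Z).

Definition small_semi_horseshoes (L : X -> Prop) : Prop :=
  forall eps, 0 < eps -> exists (N : nat) (K : X -> Prop),
    (1 <= N)%nat /\
    (forall x, K x -> L x) /\
    compact_set K /\
    set_eq (fun y => exists x, K x /\ iterZ f finv (Z.of_nat N) x = y) K /\
    (forall (k : Z) a b, K a -> K b ->
        d (iterZ f finv k a) (iterZ f finv k b) <= eps) /\
    semiconj_full_shift (iterZ f finv (Z.of_nat N)) K.

End Dyn.
End Defs.

(* Main.v *)
(** If two chain recurrent points [x], [y] are close, L-shadowing the past of [x] followed by
    the future of [y] gives a point asymptotic to both; exchanging them shows that [x] and [y]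
    are in the same class, so by compactness there are finitely many classes.

    If a class is not expansive, it contains [x <> y] whose orbits stay close. For every
    [delta] we find two equally long [delta]-chain loops at a common point which stay close to
    each other but which at some time pass through two points [r0 <> r1] not depending on
    [delta]. Shadowing at a scale smaller than [d r0 r1] all concatenations of the two loops
    then gives the horseshoe. If the pair [(x, y)] approaches the diagonal both in the past
    and in the future, take [(r0, r1) = (x, y)]: jump from [x] to [y] in the past, back to [x]
    in the future, and close up inside the class. Otherwise [(x, y)] has a limit point
    [(u, v)] off the diagonal; the pair [(u, v)] returns to itself along [delta]-chains, and
    L-shadowing the past of [u] followed by the future of [v], and conversely, connects
    [(u, u)] to [(u, v)] and back, so [(r0, r1) = (u, v)] works. *)

Require Import Defs.
From Stdlib Require Import Reals ZArith List Lra Lia Classical ClassicalEpsilon.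
From Stdlib Require Import Relation_Operators Operators_Properties.
Open Scope R_scope.

Local Arguments clos_trans {A} R x y.

(** * Finite chains as transitive closures of a step relation *)

Section Chains.
Context {A : Type} (step : A -> A -> Prop).

(** Chains in [clos_trans] have at least one step; a first piece [a] to [b] guarantees that a
    nonempty chain is left once the last step is removed. *)
Lemma clos_trans_last_step a b c :
  clos_trans step a b -> clos_trans step b c ->
  exists e, clos_trans step a e /\ step e c.
Proof.
  intros H1 H2. apply clos_trans_tn1_iff in H2. destruct H2 as [c H|e c H H2].
  - exists b; auto.
  - exists e; split; auto. apply t_trans with b; auto. now apply clos_trans_tn1_iff.
Qed.

Lemma clos_trans_first_step a b c :
  clos_trans step a b -> clos_trans step b c ->
  exists e, step a e /\ clos_trans step e c.
Proof.
  intros H1 H2. apply clos_trans_t1n_iff in H1. destruct H1 as [b H|e b H H1].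
  - exists b; auto.
  - exists e; split; auto. apply t_trans with b; auto. now apply clos_trans_t1n_iff.
Qed.

Lemma clos_trans_seq (s : Z -> A) i j :
  (i < j)%Z -> (forall k, (i <= k < j)%Z -> step (s k) (s (k + 1)%Z)) ->
  clos_trans step (s i) (s j).
Proof.
  intros Hij.
  assert (H : forall n : nat,
    (forall k, (i <= k < i + Z.of_nat (S n))%Z -> step (s k) (s (k + 1)%Z)) ->
    clos_trans step (s i) (s (i + Z.of_nat (S n))%Z)).
  { induction n as [|n IH]; intros Hs.
    - apply t_step. apply Hs. lia.
    - apply t_trans with (s (i + Z.of_nat (S n))%Z).
      + apply IH. intros k Hk. apply Hs. lia.
      + apply t_step.
        replace (i + Z.of_nat (S (S n)))%Z with (i + Z.of_nat (S n) + 1)%Z by lia.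
        apply Hs. lia. }
  specialize (H (Z.to_nat (j - i - 1))).
  replace (i + Z.of_nat (S (Z.to_nat (j - i - 1))))%Z with j in H by lia. exact H.
Qed.

Lemma clos_trans_fun a b :
  clos_trans step a b ->
  exists (n : nat) (p : nat -> A),
    (1 <= n)%nat /\ p 0%nat = a /\ p n = b /\
    forall i, (i < n)%nat -> step (p i) (p (S i)).
Proof.
  intros H. apply clos_trans_t1n_iff in H. induction H as [a b H|a b c H _ IH].
  - exists 1%nat, (fun i => match i with O => a | _ => b end).
    repeat split; auto. intros i Hi. replace i with 0%nat by lia. exact H.
  - destruct IH as (n & p & Hn & H0 & Hp & Hs).
    exists (S n), (fun i => match i with O => a | S i => p i end).
    repeat split; auto; try lia. intros [|i] Hi.
    + now rewrite H0.
    + apply Hs. lia.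
Qed.

(** The passage time [m] is kept because it later serves as the moment when two loops are
    separated. *)
Lemma clos_trans_fun_through a b c :
  clos_trans step a b -> clos_trans step b c ->
  exists (n m : nat) (p : nat -> A),
    (m < n)%nat /\ p 0%nat = a /\ p m = b /\ p n = c /\
    forall i, (i < n)%nat -> step (p i) (p (S i)).
Proof.
  intros H1 H2.
  destruct (clos_trans_fun _ _ H1) as (n1 & p1 & Hn1 & H10 & H1n & Hs1).
  destruct (clos_trans_fun _ _ H2) as (n2 & p2 & Hn2 & H20 & H2n & Hs2).
  exists (n1 + n2)%nat, n1, (fun i => if (i <? n1)%nat then p1 i else p2 (i - n1)%nat).
  repeat split.
  - lia.
  - destruct (Nat.ltb_spec 0 n1); [auto|lia].
  - rewrite Nat.ltb_irrefl, Nat.sub_diag. exact H20.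
  - destruct (Nat.ltb_spec (n1 + n2) n1); [lia|].
    replace (n1 + n2 - n1)%nat with n2 by lia. exact H2n.
  - intros i Hi.
    destruct (Nat.ltb_spec i n1), (Nat.ltb_spec (S i) n1); try lia.
    + apply Hs1; auto.
    + replace (S i - n1)%nat with 0%nat by lia. rewrite H20, <- H1n.
      replace n1 with (S i) by lia. apply Hs1. lia.
    + replace (S i - n1)%nat with (S (i - n1)) by lia. apply Hs2. lia.
Qed.

End Chains.

(** Taking [g] to be the identity enlarges the allowed jumps; projections and the diagonal map
    convert between chains of points and chains of pairs. *)
Lemma clos_trans_map {A B : Type} (R : A -> A -> Prop) (S : B -> B -> Prop) (g : A -> B) :
  (forall a b, R a b -> S (g a) (g b)) ->
  forall a b, clos_trans R a b -> clos_trans S (g a) (g b).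
Proof.
  intros Hg a b H. induction H.
  - apply t_step; auto.
  - eapply t_trans; eauto.
Qed.

(** * Metric preliminaries, integer iterates and compactness *)

Section Dynamics.
Context {X : Type} (d : X -> X -> R) (f finv : X -> X).
Context (Hd : is_metric d) (HX : compact_set d (fun _ => True)).
Context (Hf : homeomorphism d f finv).
Notation F := (iterZ f finv).

Lemma dist_ge0 x y : 0 <= d x y.
Proof. apply Hd. Qed.

Lemma dist_refl x : d x x = 0.
Proof. destruct Hd as (_ & H & _). now apply H. Qed.

Lemma dist_pos x y : x <> y -> 0 < d x y.
Proof.
  intros H. destruct (dist_ge0 x y) as [H1|H1]; auto.
  exfalso. apply H. apply Hd. auto.
Qed.

Lemma dist_sym x y : d x y = d y x.
Proof. apply Hd. Qed.

Lemma dist_tri x y z : d x z <= d x y + d y z.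
Proof. apply Hd. Qed.

Lemma iterZ_succ k x : F (k + 1) x = f (F k x).
Proof.
  destruct Hf as (_ & _ & _ & Hfi).
  destruct k as [|p|p].
  - reflexivity.
  - change (Z.pos p + 1)%Z with (Z.pos (p + 1)). simpl.
    rewrite Pos.add_1_r, Pos2Nat.inj_succ. reflexivity.
  - destruct p as [|p _] using Pos.peano_ind.
    + symmetry. apply Hfi.
    + replace (Z.neg (Pos.succ p) + 1)%Z with (Z.neg p) by lia. simpl.
      rewrite Pos2Nat.inj_succ. simpl. now rewrite Hfi.
Qed.

Lemma iterZ_add a b x : F (a + b) x = F a (F b x).
Proof.
  induction a as [|a IH|a IH] using Z.peano_ind.
  - reflexivity.
  - replace (Z.succ a + b)%Z with (a + b + 1)%Z by lia.
    unfold Z.succ. rewrite !iterZ_succ. now rewrite IH.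
  - destruct Hf as (_ & _ & Hif & _).
    rewrite <- (Hif (F (Z.pred a) (F b x))), <- (Hif (F (Z.pred a + b) x)).
    rewrite <- !iterZ_succ.
    replace (Z.pred a + b + 1)%Z with (a + b)%Z by lia.
    replace (Z.pred a + 1)%Z with a by lia. now rewrite IH.
Qed.

Lemma continuous_comp g h :
  continuous_map d g -> continuous_map d h -> continuous_map d (fun x => g (h x)).
Proof.
  intros Hg Hh x e He. destruct (Hg (h x) e He) as (r & Hr & H).
  destruct (Hh x r Hr) as (r' & Hr' & H'). exists r'. auto.
Qed.

Lemma iterZ_continuous k : continuous_map d (F k).
Proof.
  destruct Hf as (Cf & Ci & Hif & Hfi).
  induction k as [|k IH|k IH] using Z.peano_ind.
  - intros x e He. exists e. auto.
  - intros x e He. destruct (continuous_comp _ _ Cf IH x e He) as (r & Hr & H).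
    exists r; split; auto. intros y Hy. unfold Z.succ. rewrite !iterZ_succ. auto.
  - intros x e He. destruct (continuous_comp _ _ Ci IH x e He) as (r & Hr & H).
    exists r; split; auto. intros y Hy.
    rewrite <- (Hif (F (Z.pred k) x)), <- (Hif (F (Z.pred k) y)), <- !iterZ_succ.
    replace (Z.pred k + 1)%Z with k by lia. auto.
Qed.

Definition cluster (s : nat -> X) (u : X) : Prop :=
  forall r, 0 < r -> forall n0, exists n, (n0 <= n)%nat /\ d (s n) u < r.

(** Otherwise every point has a ball that the sequence avoids from some index on. Finitely many such
    balls cover [X], so a late enough term would lie in none of them. *)
Lemma cluster_exists (s : nat -> X) : exists u, cluster s u.
Proof.
  apply NNPP. intros Hno.
  set (U := fun (i : X * R * nat) z =>
    d (fst (fst i)) z < snd (fst i) /\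
    forall n, (snd i <= n)%nat -> snd (fst i) <= d (s n) (fst (fst i))).
  destruct (HX _ U) as (l & Hl).
  - intros [[u r] n0] z (Hz & Hn). simpl in *.
    exists (r - d u z). split; [lra|]. intros y Hy. split; auto. simpl.
    pose proof (dist_tri u z y). lra.
  - intros u _. apply NNPP. intros Hu. apply Hno. exists u.
    intros r Hr n0. apply NNPP. intros Hn. apply Hu. exists (u, r, n0).
    split; simpl.
    + now rewrite dist_refl.
    + intros n Hle. apply Rnot_lt_le. intros Hlt. apply Hn. exists n; auto.
  - assert (Hmax : exists n, forall i, In i l -> (snd i <= n)%nat).
    { clear. induction l as [|i l (n & Hn)].
      - exists 0%nat. intros i [].
      - exists (Nat.max (snd i) n). intros j [->|Hj]; [lia|]. specialize (Hn j Hj). lia. }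
    destruct Hmax as (n & Hn). destruct (Hl (s n) I) as (i & Hi & H1 & H2).
    specialize (H2 n (Hn i Hi)). rewrite dist_sym in H1. lra.
Qed.

Lemma cluster_pair_exists (s t : nat -> X) :
  exists u v, forall r, 0 < r -> forall n0, exists n,
    (n0 <= n)%nat /\ d (s n) u < r /\ d (t n) v < r.
Proof.
  destruct (cluster_exists s) as (u & Hu).
  (* Along the indices [phi n] the first sequence converges to [u], so it remains close to [u]
     wherever the second one clusters. *)
  assert (Hphi : forall n : nat, exists m, (n <= m)%nat /\ d (s m) u < / (INR n + 1)).
  { intros n. apply Hu. apply Rinv_0_lt_compat. pose proof (pos_INR n). lra. }
  set (phi := fun n => proj1_sig (constructive_indefinite_description _ (Hphi n))).
  assert (Hp : forall n, (n <= phi n)%nat /\ d (s (phi n)) u < / (INR n + 1))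
    by exact (fun n => proj2_sig (constructive_indefinite_description _ (Hphi n))).
  clearbody phi.
  destruct (cluster_exists (fun n => t (phi n))) as (v & Hv).
  exists u, v. intros r Hr n0.
  destruct (archimed_cor1 r Hr) as (n1 & Hn1 & Hn1').
  destruct (Hv r Hr (Nat.max n0 n1)) as (n & Hn & Hvn).
  destruct (Hp n) as (H1 & H2). exists (phi n). repeat split; auto; [lia|].
  apply Rlt_trans with (1 := H2). apply Rlt_trans with (2 := Hn1).
  assert (INR n1 <= INR n) by (apply le_INR; lia).
  apply Rinv_lt_contravar; [|lra].
  apply Rmult_lt_0_compat; [apply lt_0_INR; lia|]. pose proof (pos_INR n). lra.
Qed.

Lemma cluster_dist_le (s : nat -> X) u (g : X -> X) a r n0 :
  cluster s u -> continuous_map d g ->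
  (forall n, (n0 <= n)%nat -> d (g (s n)) a <= r) -> d (g u) a <= r.
Proof.
  intros Hu Hg Hs. apply Rnot_lt_le. intros Hlt.
  destruct (Hg u (d (g u) a - r)) as (rho & Hrho & H); [lra|].
  destruct (Hu rho Hrho n0) as (n & Hn & Hun). rewrite dist_sym in Hun.
  specialize (H _ Hun). specialize (Hs n Hn).
  pose proof (dist_tri (g u) (g (s n)) a). lra.
Qed.

Lemma closed_compact (K : X -> Prop) :
  (forall x, (forall r, 0 < r -> exists y, K y /\ d x y < r) -> K x) ->
  compact_set d K.
Proof.
  intros HK J U HU HcU.
  (* The index [None] stands for the complement of [K], which completes a cover of [K] to one of the
     whole space. *)
  destruct (HX (option J)
    (fun o z => match o with Some i => U i z | None => ~ K z end)) as (l & Hl).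
  - intros [i|]; [apply HU|]. intros x Hx. apply NNPP. intros Hno. apply Hx.
    apply HK. intros r Hr. apply NNPP. intros Hn. apply Hno. exists r; split; auto.
    intros y Hy HKy. apply Hn. exists y; auto.
  - intros x _. destruct (classic (K x)) as [H|H].
    + destruct (HcU x H) as (i & Hi). now exists (Some i).
    + now exists None.
  - exists (flat_map (fun o => match o with Some i => i :: nil | None => nil end) l).
    intros x Hx. destruct (Hl x I) as ([i|] & Hi & Hix).
    + exists i; split; auto. apply in_flat_map. exists (Some i). simpl; auto.
    + contradiction.
Qed.

(** * Chain recurrence *)

Definition jump (eps : R) (a b : X) : Prop := d (f a) b < eps.

Definition leads (x y : X) : Prop := forall eps, 0 < eps -> clos_trans (jump eps) x y.

Definition chain_equiv (x y : X) : Prop := leads x y /\ leads y x.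

Lemma iterZ_jump eps k x : 0 < eps -> jump eps (F k x) (F (k + 1) x).
Proof. intros He. unfold jump. now rewrite iterZ_succ, dist_refl. Qed.

Lemma leads_trans x y z : leads x y -> leads y z -> leads x z.
Proof. intros H1 H2 e He. apply t_trans with y; auto. Qed.

Lemma chain_equiv_sym x y : chain_equiv x y -> chain_equiv y x.
Proof. intros []; split; auto. Qed.

Lemma chain_equiv_trans x y z : chain_equiv x y -> chain_equiv y z -> chain_equiv x z.
Proof. intros [] []; split; eapply leads_trans; eauto. Qed.

(** Block [k] contributes only the times [0] to [N - 1] of [p k]; its time [N] is the start of the
    next block. *)
Definition concat (N : nat) (p : Z -> nat -> X) (i : Z) : X :=
  p (i / Z.of_nat N)%Z (Z.to_nat (i mod Z.of_nat N)).

Lemma concat_eq N p k i :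
  (i < N)%nat -> concat N p (k * Z.of_nat N + Z.of_nat i)%Z = p k i.
Proof.
  intros Hi. unfold concat.
  rewrite <- (Z.div_unique _ (Z.of_nat N) k (Z.of_nat i)) by lia.
  rewrite <- (Z.mod_unique _ (Z.of_nat N) k (Z.of_nat i)) by lia.
  now rewrite Nat2Z.id.
Qed.

Lemma block_index N (i : Z) :
  (0 < N)%nat -> exists k j, (j < N)%nat /\ i = (k * Z.of_nat N + Z.of_nat j)%Z.
Proof.
  intros HN. exists (i / Z.of_nat N)%Z, (Z.to_nat (i mod Z.of_nat N)).
  pose proof (Z.mod_pos_bound i (Z.of_nat N) ltac:(lia)).
  pose proof (Z.div_mod i (Z.of_nat N) ltac:(lia)). split; nia.
Qed.

Lemma concat_pseudo_orbit N (p : Z -> nat -> X) q delta :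
  (0 < N)%nat -> (forall k, p k 0%nat = q) -> (forall k, p k N = q) ->
  (forall k i, (i < N)%nat -> jump delta (p k i) (p k (S i))) ->
  pseudo_orbit d f delta (concat N p).
Proof.
  intros HN H0 H1 Hs i. destruct (block_index N i HN) as (k & j & Hj & ->).
  rewrite concat_eq by auto. specialize (Hs k j Hj). unfold jump in Hs.
  destruct (Nat.eq_dec (S j) N) as [E|E].
  - replace (k * Z.of_nat N + Z.of_nat j + 1)%Z
      with ((k + 1) * Z.of_nat N + Z.of_nat 0)%Z by nia.
    rewrite concat_eq, H0 by auto. now rewrite E, H1 in Hs.
  - replace (k * Z.of_nat N + Z.of_nat j + 1)%Z
      with (k * Z.of_nat N + Z.of_nat (S j))%Z by lia.
    rewrite concat_eq by lia. exact Hs.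
Qed.

Lemma periodic_mul {A : Type} (xs : Z -> A) n :
  (forall k, xs (k + n)%Z = xs k) -> forall m k, xs (k + m * n)%Z = xs k.
Proof.
  intros H m. induction m as [|m IH|m IH] using Z.peano_ind; intros k.
  - f_equal; lia.
  - replace (k + Z.succ m * n)%Z with (k + m * n + n)%Z by lia. now rewrite H.
  - rewrite <- H. replace (k + Z.pred m * n + n)%Z with (k + m * n)%Z by lia. apply IH.
Qed.

Lemma periodic_pseudo_orbit_chain eps xs i j :
  pseudo_orbit d f eps xs -> periodic_seq xs -> clos_trans (jump eps) (xs i) (xs j).
Proof.
  intros Hp (n & Hn & Hper).
  (* This many periods move [j] to the right of [i]. *)
  rewrite <- (periodic_mul _ _ Hper (Z.abs i + Z.abs j + 1) j).
  apply clos_trans_seq; [nia|]. intros k _. apply Hp.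
Qed.

Lemma CR_of_iff x y : CR_of d f x y <-> chain_equiv x y.
Proof.
  split.
  - intros H. split; intros eps He;
      destruct (H eps He) as (xs & Hp & Hper & (i & <-) & (j & <-));
      now apply periodic_pseudo_orbit_chain.
  - intros [Hxy Hyx] eps He.
    destruct (clos_trans_fun_through _ _ _ _ (Hxy eps He) (Hyx eps He))
      as (N & m & p & Hm & H0 & Hpm & HpN & Hs).
    exists (concat N (fun _ => p)). split; [|split; [|split]].
    + apply concat_pseudo_orbit with x; auto; lia.
    + exists (Z.of_nat N). split; [lia|]. intros k.
      destruct (block_index N k ltac:(lia)) as (a & b & Hb & ->).
      replace (a * Z.of_nat N + Z.of_nat b + Z.of_nat N)%Z
        with ((a + 1) * Z.of_nat N + Z.of_nat b)%Z by lia.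
      now rewrite !concat_eq.
    + exists (0 * Z.of_nat N + Z.of_nat 0)%Z. rewrite concat_eq; auto; lia.
    + exists (0 * Z.of_nat N + Z.of_nat m)%Z. rewrite concat_eq; auto.
Qed.

(** A chain ending at [y'] is redirected to [y] in its last step; a chain starting at [y'] is
    restarted at [y] in its first step, by continuity of [f]. *)
Lemma chain_equiv_closed x y :
  (forall r, 0 < r -> exists y', chain_equiv x y' /\ d y y' < r) -> chain_equiv x y.
Proof.
  intros H. split; intros eps He.
  - destruct (H (eps / 2)) as (y' & [Hxy Hyx] & Hd'); [lra|].
    destruct (clos_trans_last_step _ _ _ _
      (t_trans _ _ _ _ _ (Hxy (eps / 2) ltac:(lra)) (Hyx (eps / 2) ltac:(lra)))
      (Hxy (eps / 2) ltac:(lra))) as (e & H1 & H2).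
    apply t_trans with e.
    + revert H1. apply (clos_trans_map _ _ (fun a => a)). unfold jump. intros; lra.
    + apply t_step. unfold jump in *. pose proof (dist_tri (f e) y' y).
      rewrite (dist_sym y' y) in *. lra.
  - destruct (proj1 Hf y (eps / 2)) as (r & Hr & Hc); [lra|].
    destruct (H r Hr) as (y' & [Hxy Hyx] & Hd').
    destruct (clos_trans_first_step _ _ _ _ (Hyx (eps / 2) ltac:(lra))
      (t_trans _ _ _ _ _ (Hxy (eps / 2) ltac:(lra)) (Hyx (eps / 2) ltac:(lra))))
      as (e & H1 & H2).
    apply t_trans with e.
    + apply t_step. unfold jump in *. pose proof (dist_tri (f y) (f y') e).
      specialize (Hc _ Hd'). lra.
    + revert H2. apply (clos_trans_map _ _ (fun a => a)). unfold jump. intros; lra.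
Qed.

(** To return from [f y], take a chain [y, p1, p2, ...] to [x]. As [p1] is close to [f y],
    continuity allows a jump from [f y] directly to [p2]; a loop at [x] is appended to make the
    chain long enough. *)
Lemma chain_equiv_f x y : chain_equiv x y -> chain_equiv x (f y).
Proof.
  intros [Hxy Hyx]. split; intros eps He.
  - apply t_trans with y; auto. apply t_step. unfold jump. now rewrite dist_refl.
  - destruct (proj1 Hf (f y) (eps / 2)) as (r & Hr & Hc); [lra|].
    set (e := Rmin r (eps / 2)).
    assert (He' : 0 < e) by (apply Rmin_glb_lt; lra).
    assert (e <= r) by apply Rmin_l. assert (e <= eps / 2) by apply Rmin_r.
    assert (Hlong : clos_trans (jump e) x x) by (apply t_trans with y; auto).
    destruct (clos_trans_first_step _ _ _ _ (Hyx e He') Hlong) as (p1 & H1 & H2).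
    destruct (clos_trans_first_step _ _ _ _ H2 Hlong) as (p2 & H3 & H4).
    apply t_trans with p2.
    + apply t_step. unfold jump in *. pose proof (dist_tri (f (f y)) (f p1) p2).
      specialize (Hc p1 ltac:(lra)). lra.
    + revert H4. apply (clos_trans_map _ _ (fun a => a)). unfold jump. intros; lra.
Qed.

(** Dually, in a chain [..., p2, p1, y] the point [p1] is close to [finv y], so [p2] can jump
    there. *)
Lemma chain_equiv_finv x y : chain_equiv x y -> chain_equiv x (finv y).
Proof.
  destruct Hf as (_ & Ci & Hif & Hfi).
  intros [Hxy Hyx]. split; intros eps He.
  - destruct (Ci y (eps / 2)) as (r & Hr & Hc); [lra|].
    set (e := Rmin r (eps / 2)).
    assert (He' : 0 < e) by (apply Rmin_glb_lt; lra).
    assert (e <= r) by apply Rmin_l. assert (e <= eps / 2) by apply Rmin_r.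
    assert (Hlong : clos_trans (jump e) x x) by (apply t_trans with y; auto).
    destruct (clos_trans_last_step _ _ _ _ Hlong (Hxy e He')) as (p1 & H1 & H2).
    destruct (clos_trans_last_step _ _ _ _ Hlong H1) as (p2 & H3 & H4).
    apply t_trans with p2.
    + revert H3. apply (clos_trans_map _ _ (fun a => a)). unfold jump. intros; lra.
    + apply t_step. unfold jump in *. pose proof (dist_tri (f p2) p1 (finv y)).
      rewrite dist_sym in H2. specialize (Hc (f p1) ltac:(lra)).
      rewrite Hif, dist_sym in Hc. lra.
  - apply t_trans with y; auto. apply t_step. unfold jump. now rewrite Hfi, dist_refl.
Qed.

Lemma chain_equiv_iterZ x y k : chain_equiv x y -> chain_equiv x (F k y).
Proof.
  intros H. destruct Hf as (_ & _ & Hif & _).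
  induction k as [|k IH|k IH] using Z.peano_ind.
  - exact H.
  - unfold Z.succ. rewrite iterZ_succ. now apply chain_equiv_f.
  - rewrite <- (Hif (F (Z.pred k) y)), <- iterZ_succ.
    replace (Z.pred k + 1)%Z with k by lia. now apply chain_equiv_finv.
Qed.

(** * Chains of pairs and returns to limit pairs *)

(** The bound [tau] is imposed on the pair reached, so a chain bounds every pair after its initial
    one. *)
Definition jump2 (delta tau : R) (P Q : X * X) : Prop :=
  jump delta (fst P) (fst Q) /\ jump delta (snd P) (snd Q) /\ d (fst Q) (snd Q) <= tau.

(* Satisfied by accumulation points of [(F k x, F k y)] as [k] tends to [+oo] and as
   [k] tends to [-oo] alike; [K] makes [j - i] as large as desired. *)
Definition returns (x y u v : X) : Prop :=
  forall r, 0 < r -> forall K, exists i j, (i + K <= j)%Z /\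
    d u (F i x) < r /\ d v (F i y) < r /\ d u (F j x) < r /\ d v (F j y) < r.

(** The chain jumps from [(F a u, F a v)] onto the orbit of [(x, y)] near time [i], follows it, and
    jumps off near time [j] onto [(F b u, F b v)]. *)
Lemma clos_trans_return x y u v tau a b delta :
  returns x y u v -> (forall k, d (F k x) (F k y) <= tau) ->
  d (F b u) (F b v) <= tau -> 0 < delta ->
  clos_trans (jump2 delta tau) (F a u, F a v) (F b u, F b v).
Proof.
  intros Hr Ht Hb Hdl.
  destruct (iterZ_continuous (a + 1) u delta Hdl) as (r1 & Hr1 & C1).
  destruct (iterZ_continuous (a + 1) v delta Hdl) as (r2 & Hr2 & C2).
  destruct (iterZ_continuous b u delta Hdl) as (r3 & Hr3 & C3).
  destruct (iterZ_continuous b v delta Hdl) as (r4 & Hr4 & C4).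
  (* The gap [a - b + 3] makes the landing time [a + 1 + i] smaller than the departure time
     [b + j - 1]. *)
  destruct (Hr (Rmin (Rmin r1 r2) (Rmin r3 r4))
    ltac:(repeat apply Rmin_glb_lt; auto) (a - b + 3)%Z)
    as (i & j & Hij & H1 & H2 & H3 & H4).
  pose proof (Rmin_l (Rmin r1 r2) (Rmin r3 r4)). pose proof (Rmin_r (Rmin r1 r2) (Rmin r3 r4)).
  pose proof (Rmin_l r1 r2). pose proof (Rmin_r r1 r2).
  pose proof (Rmin_l r3 r4). pose proof (Rmin_r r3 r4).
  specialize (C1 (F i x) ltac:(lra)). specialize (C2 (F i y) ltac:(lra)).
  specialize (C3 (F j x) ltac:(lra)). specialize (C4 (F j y) ltac:(lra)).
  rewrite <- iterZ_add in C1, C2, C3, C4.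
  apply t_trans with (F (a + 1 + i) x, F (a + 1 + i) y).
  { apply t_step. unfold jump2, jump; simpl. rewrite <- !iterZ_succ. auto. }
  apply t_trans with (F (b + j - 1) x, F (b + j - 1) y).
  - apply (clos_trans_seq _ (fun k => (F k x, F k y))); [lia|].
    intros k _. unfold jump2; simpl. auto using iterZ_jump.
  - apply t_step. unfold jump2, jump; simpl. rewrite <- !iterZ_succ.
    replace (b + j - 1 + 1)%Z with (b + j)%Z by lia.
    rewrite (dist_sym _ (F b u)), (dist_sym _ (F b v)). auto.
Qed.

Lemma returns_diag x y u v : returns x y u v -> returns x x u u.
Proof.
  intros H r Hr K. destruct (H r Hr K) as (i & j & H'). exists i, j. tauto.
Qed.

Lemma clos_trans_jump2_fst delta tau P Q :
  clos_trans (jump2 delta tau) P Q -> clos_trans (jump delta) (fst P) (fst Q).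
Proof. apply clos_trans_map. unfold jump2. tauto. Qed.

Lemma clos_trans_jump2_snd delta tau P Q :
  clos_trans (jump2 delta tau) P Q -> clos_trans (jump delta) (snd P) (snd Q).
Proof. apply clos_trans_map. unfold jump2. tauto. Qed.

Lemma returns_chain_recurrent x y u v : returns x y u v -> chain_equiv u u.
Proof.
  intros H. assert (leads u u); [|split; auto].
  intros eps He. apply (clos_trans_jump2_fst eps 0 (F 0 u, F 0 u) (F 0 u, F 0 u)).
  apply clos_trans_return with x x; auto.
  - now apply returns_diag with y v.
  - intros k. rewrite dist_refl. lra.
  - rewrite dist_refl. lra.
Qed.

Lemma clos_trans_diag delta tau a b :
  0 <= tau -> clos_trans (jump delta) a b -> clos_trans (jump2 delta tau) (a, a) (b, b).
Proof.
  intros Ht. apply (clos_trans_map _ _ (fun a => (a, a))).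
  intros a' b' H. unfold jump2; simpl. rewrite dist_refl. auto.
Qed.

(** * Points joining one past to another future *)

(** The analogue of the bracket of hyperbolic dynamics. The asymptotics are recorded in the form
    used by chains: one time [m] serves both directions. *)
Definition bracket (eps : R) (x y z : X) : Prop :=
  (forall k, (k < 0)%Z -> d (F k z) (F k x) <= eps) /\
  (forall k, (0 <= k)%Z -> d (F k z) (F k y) <= eps) /\
  forall r, 0 < r -> exists m, (0 < m)%Z /\
    d (F (- m) z) (F (- m) x) < r /\ d (F m z) (F m y) < r.

Lemma L_shadowing_bracket eps :
  L_shadowing d f finv -> 0 < eps -> exists delta, 0 < delta /\
    forall x y, d x y <= delta -> exists z, bracket eps x y z.
Proof.
  intros HL He. destruct (HL eps He) as (delta & Hdl & H). exists delta; split; auto.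
  intros x y Hxy.
  (* The only jump of this sequence occurs at [k = -1], from [F (-1) x] to [y], and has size
     [d x y]. *)
  destruct (H (fun k => if (k <? 0)%Z then F k x else F k y)) as (z & Hz & Hz0).
  - assert (Hk : forall k,
      d (f (if (k <? 0)%Z then F k x else F k y))
        (if (k + 1 <? 0)%Z then F (k + 1) x else F (k + 1) y) =
      if (k =? -1)%Z then d x y else 0).
    { intros k. destruct (Z.ltb_spec k 0), (Z.ltb_spec (k + 1) 0), (Z.eqb_spec k (-1));
        try lia; rewrite <- ?iterZ_succ, ?dist_refl; auto.
      subst k. reflexivity. }
    split.
    + intros k. rewrite Hk. destruct (k =? -1)%Z; lra.
    + intros r Hr. exists 2%Z. intros k Hle. rewrite Hk.
      destruct (Z.eqb_spec k (-1)); [lia|auto].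
  - exists z. repeat split.
    + intros k Hk. specialize (Hz k). destruct (Z.ltb_spec k 0); [auto|lia].
    + intros k Hk. specialize (Hz k). destruct (Z.ltb_spec k 0); [lia|auto].
    + intros r Hr. destruct (Hz0 r Hr) as (N & HN).
      exists (Z.abs N + 1)%Z. split; [lia|].
      pose proof (HN (- (Z.abs N + 1))%Z ltac:(lia)) as H1.
      pose proof (HN (Z.abs N + 1)%Z ltac:(lia)) as H2.
      destruct (Z.ltb_spec (- (Z.abs N + 1)) 0); [|lia].
      destruct (Z.ltb_spec (Z.abs N + 1) 0); [lia|auto].
Qed.

(* The second coordinate passes from the past of [w1] to the future of [w2] along [z]. *)
Lemma clos_trans_bracket u w1 w2 z m delta tau :
  (0 < m)%Z -> 0 < delta ->
  d (F (- m) z) (F (- m) w1) < delta -> d (F m z) (F m w2) < delta ->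
  (forall k, d (F k u) (F k z) <= tau) -> d (F m u) (F m w2) <= tau ->
  clos_trans (jump2 delta tau) (F (- m - 1) u, F (- m - 1) w1) (F m u, F m w2).
Proof.
  intros Hm Hdl H1 H2 Hz Ht. apply t_trans with (F (- m) u, F (- m) z).
  - apply t_step. unfold jump2, jump; simpl. rewrite <- !iterZ_succ.
    replace (- m - 1 + 1)%Z with (- m)%Z by lia. rewrite dist_refl, dist_sym. auto.
  - apply t_trans with (F (m - 1) u, F (m - 1) z).
    + apply (clos_trans_seq _ (fun k => (F k u, F k z))); [lia|].
      intros k _. unfold jump2; simpl. auto using iterZ_jump.
    + apply t_step. unfold jump2, jump; simpl. rewrite <- !iterZ_succ.
      replace (m - 1 + 1)%Z with m by lia. rewrite dist_refl. auto.
Qed.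

(** * Finiteness of the set of classes *)

Lemma chain_recurrent_close :
  L_shadowing d f finv -> exists delta, 0 < delta /\
    forall x y, chain_equiv x x -> chain_equiv y y -> d x y <= delta -> chain_equiv x y.
Proof.
  intros HL. destruct (L_shadowing_bracket 1 HL ltac:(lra)) as (delta & Hdl & H).
  exists delta; split; auto.
  assert (Hxy : forall x y, chain_equiv x x -> chain_equiv y y -> d x y <= delta -> leads x y).
  { intros x y Hx Hy Hxy eps He. destruct (H x y Hxy) as (z & _ & _ & Hz).
    destruct (Hz eps He) as (m & Hm & H1 & H2).
    (* The chain goes from [x] to its own past inside its class, along [z] to the future of [y], and
       from there back to [y]. *)
    apply t_trans with (F (- m - 1) x); [now apply chain_equiv_iterZ|].
    apply t_trans with (F m y); [|now apply (chain_equiv_iterZ y y m)].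
    apply (clos_trans_jump2_snd eps eps (F (- m - 1) z, _) (F m z, _)).
    apply clos_trans_bracket with z; auto; [|lra].
    intros k. rewrite dist_refl. lra. }
  intros x y Hx Hy Hd'. split; [|rewrite dist_sym in Hd']; auto.
Qed.

Lemma finitely_many_classes :
  L_shadowing d f finv -> finitely_many_CR_classes d f.
Proof.
  intros HL. destruct (chain_recurrent_close HL) as (delta & Hdl & Hclose).
  destruct (HX X (fun c x => d c x < delta / 2)) as (l & Hl).
  - intros c x Hx. exists (delta / 2 - d c x). split; [lra|].
    intros y Hy. pose proof (dist_tri c x y). lra.
  - intros x _. exists x. rewrite dist_refl. lra.
  (* The entry of a centre [c] is the union of the classes meeting its ball. Recurrent points in
     that ball are within [delta] of each other, so at most one class occurs. *)
  - exists (map (fun c y => exists x, CR_of d f x x /\ d c x < delta / 2 /\ CR_of d f x y) l).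
    intros L (x & Hx & HLx). destruct (Hl x I) as (c & Hc & Hcx).
    eexists. split; [apply in_map; exact Hc|].
    intros y. rewrite (HLx y). split.
    + intros Hy. exists x. auto.
    + intros (x' & Hx' & Hcx' & Hy). rewrite CR_of_iff in *.
      apply chain_equiv_trans with x'; auto. apply Hclose; auto.
      pose proof (dist_tri x c x'). rewrite (dist_sym x c) in *. lra.
Qed.

(** * The shadowing property *)

(** Replacing a pseudo orbit by true orbits outside [[-n, n]] leaves finitely many jumps, so
    L-shadowing applies. A cluster point of the shadowing points for all [n] shadows the whole
    sequence; the scale [eps / 2] keeps the final inequality strict. *)
Lemma L_shadowing_shadowing : L_shadowing d f finv -> shadowing d f finv.
Proof.
  intros HL eps He. destruct (HL (eps / 2) ltac:(lra)) as (delta & Hdl & H).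
  exists delta; split; auto. intros xs Hxs.
  assert (Hn : forall n : nat, exists z,
    forall k, (Z.abs k <= Z.of_nat n)%Z -> d (F k z) (xs k) <= eps / 2).
  { intros n.
    set (n' := Z.of_nat n).
    set (ys := fun k => if (k <? - n')%Z then F (k + n') (xs (- n')%Z)
      else if (n' <? k)%Z then F (k - n') (xs n') else xs k).
    assert (Hys : forall k, (Z.abs k <= n')%Z -> ys k = xs k).
    { intros k Hk. unfold ys.
      destruct (Z.ltb_spec k (- n')); [lia|]. destruct (Z.ltb_spec n' k); [lia|auto]. }
    assert (Hlo : forall k, (k <= - n')%Z -> ys k = F (k + n') (xs (- n')%Z)).
    { intros k Hk. unfold ys. destruct (Z.ltb_spec k (- n')); auto.
      replace k with (- n')%Z by lia. destruct (Z.ltb_spec n' (- n')); [lia|].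
      replace (- n' + n')%Z with 0%Z by lia. reflexivity. }
    assert (Hhi : forall k, (n' <= k)%Z -> ys k = F (k - n') (xs n')).
    { intros k Hk. unfold ys. destruct (Z.ltb_spec k (- n')); [lia|].
      destruct (Z.ltb_spec n' k); auto.
      replace k with n' by lia. rewrite Z.sub_diag. reflexivity. }
    assert (Hout : forall k, (k < - n' \/ n' <= k)%Z -> d (f (ys k)) (ys (k + 1)%Z) = 0).
    { intros k [Hk|Hk].
      - rewrite !Hlo, <- iterZ_succ by lia.
        replace (k + n' + 1)%Z with (k + 1 + n')%Z by lia. apply dist_refl.
      - rewrite !Hhi, <- iterZ_succ by lia.
        replace (k - n' + 1)%Z with (k + 1 - n')%Z by lia. apply dist_refl. }
    destruct (H ys) as (z & Hz & _).
    - split.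
      + intros k. destruct (classic (k < - n' \/ n' <= k)%Z) as [Hk|Hk].
        * rewrite Hout by auto. lra.
        * rewrite !Hys by lia. specialize (Hxs k). lra.
      + intros r Hr. exists (n' + 1)%Z. intros k Hk. rewrite Hout by lia. auto.
    - exists z. intros k Hk. rewrite <- Hys; auto. }
  set (z := fun n => proj1_sig (constructive_indefinite_description _ (Hn n))).
  assert (Hz : forall n k, (Z.abs k <= Z.of_nat n)%Z -> d (F k (z n)) (xs k) <= eps / 2)
    by exact (fun n => proj2_sig (constructive_indefinite_description _ (Hn n))).
  clearbody z. destruct (cluster_exists z) as (y & Hy). exists y. intros k.
  assert (d (F k y) (xs k) <= eps / 2); [|lra].
  apply cluster_dist_le with z (Z.to_nat (Z.abs k)); auto using iterZ_continuous.
  intros n Hle. apply Hz. lia.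
Qed.

(** * Semi-horseshoes from two loops *)

Definition has_semi_horseshoe (x0 : X) (eps : R) : Prop :=
  exists (M : nat) (K : X -> Prop),
    (1 <= M)%nat /\ (forall x, K x -> chain_equiv x0 x) /\ compact_set d K /\
    set_eq (fun y => exists x, K x /\ F (Z.of_nat M) x = y) K /\
    (forall k a b, K a -> K b -> d (F k a) (F k b) <= eps) /\
    semiconj_full_shift d (F (Z.of_nat M)) K.

(* A chain of pairs starting and ending on the diagonal encodes two chains of the same length
   with common endpoints, at distance at most [tau] from each other at every time. *)
Definition loops_through (x0 r0 r1 : X) (tau delta : R) : Prop :=
  exists q, chain_equiv x0 q /\
    clos_trans (jump2 delta tau) (q, q) (r0, r1) /\
    clos_trans (jump2 delta tau) (r0, r1) (q, q).

(** * The horseshoe coded by two loops [p true] and [p false] at [q], separated at time [j0] *)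

Section Horseshoe.
Context (x0 q : X) (N j0 : nat) (p : bool -> nat -> X) (rho delta rho0 tau : R).
Context (Hq : chain_equiv x0 q) (HN : (0 < N)%nat) (Hj0 : (j0 < N)%nat).
Context (Hp0 : forall b, p b 0%nat = q) (HpN : forall b, p b N = q).
Context (Hjump : forall b i, (i < N)%nat -> jump delta (p b i) (p b (S i))).
Context (Htau : forall i, (i < N)%nat -> d (p true i) (p false i) <= tau).
Context (Hsep : 2 * rho < d (p true j0) (p false j0)).
Context (Hshadow : forall xs, pseudo_orbit d f delta xs ->
  exists y, forall k, d (F k y) (xs k) < rho).
Context (Hrho : rho <= rho0).
Context (Hclose : forall x y, chain_equiv x x -> chain_equiv y y -> d x y <= rho0 ->
  chain_equiv x y).

Definition follows (b : bool) (k : Z) (z : X) : Prop :=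
  forall j, (j < N)%nat -> d (F (k * Z.of_nat N + Z.of_nat j) z) (p b j) <= rho.

Definition horseshoe (z : X) : Prop :=
  chain_equiv x0 z /\ forall k, exists b, follows b k z.

(** Following a loop is decided classically; on [horseshoe], not following [p true] forces following
    [p false], hence the default [false]. *)
Definition itinerary (z : X) (k : Z) : bool :=
  if excluded_middle_informative (follows true k z) then true else false.

(** At time [j0] the two loops are more than [2 * rho] apart, so no point is [rho]-close to both. *)
Lemma follows_unique b b' k z : follows b k z -> follows b' k z -> b = b'.
Proof.
  assert (H : follows true k z -> follows false k z -> False).
  { intros H1 H2. specialize (H1 j0 Hj0). specialize (H2 j0 Hj0).
    pose proof (dist_tri (p true j0) (F (k * Z.of_nat N + Z.of_nat j0) z) (p false j0)).
    rewrite (dist_sym (p true j0) (F _ z)) in *. lra. }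
  destruct b, b'; tauto.
Qed.

Lemma follows_itinerary k z : (exists b, follows b k z) -> follows (itinerary z k) k z.
Proof.
  unfold itinerary. destruct (excluded_middle_informative (follows true k z)); auto.
  intros [[|] H]; tauto.
Qed.

Lemma itinerary_eq b k z : follows b k z -> itinerary z k = b.
Proof. intros H. apply follows_unique with k z; auto. apply follows_itinerary. eauto. Qed.

Lemma not_follows_open b k z :
  ~ follows b k z -> exists r, 0 < r /\ forall z', d z z' < r -> ~ follows b k z'.
Proof.
  intros H. apply not_all_ex_not in H as [j H]. apply imply_to_and in H as [Hj H].
  destruct (iterZ_continuous (k * Z.of_nat N + Z.of_nat j) z
    (d (F (k * Z.of_nat N + Z.of_nat j) z) (p b j) - rho)) as (r & Hr & Hc); [lra|].
  exists r; split; auto. intros z' Hz' Hf'. specialize (Hf' j Hj). specialize (Hc z' Hz').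
  pose proof (dist_tri (F (k * Z.of_nat N + Z.of_nat j) z)
    (F (k * Z.of_nat N + Z.of_nat j) z') (p b j)). lra.
Qed.

Lemma follows_shift b k m z :
  follows b k (F (m * Z.of_nat N) z) <-> follows b (k + m) z.
Proof.
  unfold follows. split; intros H j Hj; specialize (H j Hj);
    rewrite <- ?iterZ_add in *.
  - replace ((k + m) * Z.of_nat N + Z.of_nat j)%Z
      with (k * Z.of_nat N + Z.of_nat j + m * Z.of_nat N)%Z by lia. exact H.
  - replace (k * Z.of_nat N + Z.of_nat j + m * Z.of_nat N)%Z
      with ((k + m) * Z.of_nat N + Z.of_nat j)%Z by lia. exact H.
Qed.

Lemma horseshoe_shift m z : horseshoe z -> horseshoe (F (m * Z.of_nat N) z).
Proof.
  intros [Hz Hb]. split; [now apply chain_equiv_iterZ|].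
  intros k. destruct (Hb (k + m)%Z) as (b & H). exists b. now apply follows_shift.
Qed.

(** Both conditions are closed: the class is closed, and a point that follows neither loop in block
    [k] has a neighbourhood of such points. *)
Lemma horseshoe_compact : compact_set d horseshoe.
Proof.
  apply closed_compact. intros z Hz. split.
  - apply chain_equiv_closed. intros r Hr. destruct (Hz r Hr) as (y & [Hy _] & Hzy).
    exists y; auto.
  - intros k. apply NNPP. intros Hno.
    destruct (not_follows_open true k z) as (r1 & Hr1 & H1); [intros ?; eauto|].
    destruct (not_follows_open false k z) as (r2 & Hr2 & H2); [intros ?; eauto|].
    destruct (Hz (Rmin r1 r2)) as (y & [_ Hy] & Hzy); [now apply Rmin_glb_lt|].
    pose proof (Rmin_l r1 r2). pose proof (Rmin_r r1 r2).
    destruct (Hy k) as ([|] & Hb).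
    + apply (H1 y); auto; lra.
    + apply (H2 y); auto; lra.
Qed.

Lemma horseshoe_diam k a b :
  horseshoe a -> horseshoe b -> d (F k a) (F k b) <= 2 * rho + tau.
Proof.
  intros [_ Ha] [_ Hb]. destruct (block_index N k HN) as (i & j & Hj & ->).
  destruct (Ha i) as (ba & Ha'). destruct (Hb i) as (bb & Hb').
  specialize (Ha' j Hj). specialize (Hb' j Hj).
  set (k := (i * Z.of_nat N + Z.of_nat j)%Z) in *.
  assert (d (p ba j) (p bb j) <= tau).
  { pose proof (Htau j Hj). pose proof (dist_ge0 (p true j) (p false j)).
    destruct ba, bb; rewrite ?dist_refl; auto; try lra. now rewrite dist_sym. }
  pose proof (dist_tri (F k a) (p ba j) (F k b)).
  pose proof (dist_tri (p ba j) (p bb j) (F k b)).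
  rewrite (dist_sym (p bb j) (F k b)) in *. lra.
Qed.

(* The shadowing point need not be periodic; a limit point of its orbit under the period
   still shadows, is chain recurrent and close to [q], so it lies in the class of [x0]. *)
Lemma horseshoe_periodic_itinerary (s : Z -> bool) m :
  (0 < m)%Z -> (forall k, s (k + m)%Z = s k) ->
  exists z, chain_equiv x0 z /\ forall k, follows (s k) k z.
Proof.
  intros Hm Hs.
  destruct (Hshadow (concat N (fun k => p (s k)))) as (y & Hy).
  { apply concat_pseudo_orbit with q; auto. }
  set (M := (m * Z.of_nat N)%Z). assert (HM : (0 < M)%Z) by (unfold M; nia).
  destruct (cluster_exists (fun n => F (Z.of_nat n * M) y)) as (z & Hz).
  assert (Hfol : forall k, follows (s k) k z).
  { intros k j Hj. eapply cluster_dist_le with (n0 := 0%nat);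
      [exact Hz|apply iterZ_continuous|].
    intros n _. simpl. rewrite <- iterZ_add.
    replace (k * Z.of_nat N + Z.of_nat j + Z.of_nat n * M)%Z
      with ((k + Z.of_nat n * m) * Z.of_nat N + Z.of_nat j)%Z by (unfold M; ring).
    specialize (Hy ((k + Z.of_nat n * m) * Z.of_nat N + Z.of_nat j)%Z).
    rewrite concat_eq, (periodic_mul s m Hs) in Hy by auto. lra. }
  exists z; split; auto.
  apply chain_equiv_trans with q; auto. apply Hclose.
  - apply chain_equiv_trans with x0; auto using chain_equiv_sym.
  (* Two visits of the orbit of [y] near [z], chosen with indices at least [K] apart, give the
     required return. *)
  - apply (returns_chain_recurrent y y z z). intros r Hr K.
    destruct (Hz r Hr 0%nat) as (n1 & _ & H1).
    destruct (Hz r Hr (n1 + Z.to_nat K)%nat) as (n2 & Hn & H2).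
    exists (Z.of_nat n1 * M)%Z, (Z.of_nat n2 * M)%Z.
    rewrite dist_sym in H1, H2. repeat split; auto. nia.
  - pose proof (Hfol 0%Z 0%nat HN) as H. simpl in H. rewrite Hp0, dist_sym in H. lra.
Qed.

Lemma horseshoe_itinerary (s : Z -> bool) :
  exists z, chain_equiv x0 z /\ forall k, follows (s k) k z.
Proof.
  assert (Hn : forall n : nat, exists z, chain_equiv x0 z /\
    forall k, (Z.abs k <= Z.of_nat n)%Z -> follows (s k) k z).
  { intros n. set (c := Z.of_nat n). set (m := (2 * c + 1)%Z).
    (* The word of [s] on [[-c, c]] is repeated with period [m = 2 * c + 1]; adding [c] moves this
       window to the range where [mod m] is the identity. *)
    destruct (horseshoe_periodic_itinerary (fun k => s ((k + c) mod m - c)%Z) m)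
      as (z & Hz & Hb).
    - lia.
    - intros k. f_equal. replace (k + m + c)%Z with (k + c + 1 * m)%Z by lia.
      now rewrite Z.mod_add by lia.
    - exists z; split; auto. intros k Hk. specialize (Hb k). simpl in Hb.
      rewrite Z.mod_small in Hb by lia.
      now replace (k + c - c)%Z with k in Hb by lia. }
  set (z := fun n => proj1_sig (constructive_indefinite_description _ (Hn n))).
  assert (Hz : forall n, chain_equiv x0 (z n) /\
    forall k, (Z.abs k <= Z.of_nat n)%Z -> follows (s k) k (z n))
    by exact (fun n => proj2_sig (constructive_indefinite_description _ (Hn n))).
  clearbody z. destruct (cluster_exists z) as (y & Hy). exists y. split.
  - apply chain_equiv_closed. intros r Hr. destruct (Hy r Hr 0%nat) as (n & _ & Hd').
    exists (z n). rewrite dist_sym. split; auto. apply Hz.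
  - intros k j Hj. apply cluster_dist_le with z (Z.to_nat (Z.abs k));
      auto using iterZ_continuous.
    intros n Hle. apply Hz; auto. lia.
Qed.

(** A point of the horseshoe does not follow the other loop in block [k], and this is an open
    condition; nearby points of the horseshoe must then follow the same loop. *)
Lemma itinerary_locally_constant z k :
  horseshoe z -> exists r, 0 < r /\
    forall z', horseshoe z' -> d z z' < r -> itinerary z' k = itinerary z k.
Proof.
  intros [_ Hz].
  destruct (not_follows_open (negb (itinerary z k)) k z) as (r & Hr & H).
  { intros Hc. assert (E : itinerary z k = negb (itinerary z k)) by now apply itinerary_eq.
    destruct (itinerary z k); discriminate. }
  exists r; split; auto. intros z' [_ Hz'] Hd'. specialize (H z' Hd').
  destruct (Hz' k) as (b & Hb). rewrite (itinerary_eq b k z' Hb).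
  destruct b, (itinerary z k); auto; contradiction.
Qed.

Lemma itinerary_continuous : continuous_to_shift d horseshoe itinerary.
Proof.
  intros z Hz n.
  assert (H : forall n : nat, exists r, 0 < r /\ forall z', horseshoe z' -> d z z' < r ->
    forall k, (Z.abs k < Z.of_nat n)%Z -> itinerary z' k = itinerary z k).
  { clear n. induction n as [|n (r & Hr & IH)].
    - exists 1. split; [lra|]. intros; lia.
    - destruct (itinerary_locally_constant z (Z.of_nat n) Hz) as (r1 & Hr1 & H1).
      destruct (itinerary_locally_constant z (- Z.of_nat n) Hz) as (r2 & Hr2 & H2).
      exists (Rmin r (Rmin r1 r2)). split; [repeat apply Rmin_glb_lt; auto|].
      intros z' Hz' Hd' k Hk.
      pose proof (Rmin_l r (Rmin r1 r2)). pose proof (Rmin_r r (Rmin r1 r2)).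
      pose proof (Rmin_l r1 r2). pose proof (Rmin_r r1 r2).
      destruct (Z.eq_dec k (Z.of_nat n)) as [->|]; [apply H1; auto; lra|].
      destruct (Z.eq_dec k (- Z.of_nat n)) as [->|]; [apply H2; auto; lra|].
      apply IH; auto; [lra|lia]. }
  destruct (H (Z.to_nat (n + 1))) as (r & Hr & H'). exists r; split; auto.
  intros z' Hz' Hd' k Hk. apply H'; auto. lia.
Qed.

Lemma horseshoe_spec :
  has_semi_horseshoe x0 (2 * rho + tau).
Proof.
  exists N, horseshoe. split; [lia|]. split; [intros x Hx; apply Hx|].
  split; [apply horseshoe_compact|]. split; [|split; [apply horseshoe_diam|]].
  - intros y. split.
    + intros (x & Hx & <-). rewrite <- (Z.mul_1_l (Z.of_nat N)). now apply horseshoe_shift.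
    + intros Hy. exists (F (-1 * Z.of_nat N) y). split; [now apply horseshoe_shift|].
      rewrite <- iterZ_add.
      now replace (Z.of_nat N + -1 * Z.of_nat N)%Z with 0%Z by lia.
  - exists itinerary. split; [apply itinerary_continuous|]. split.
    + intros s. destruct (horseshoe_itinerary s) as (z & Hz & Hs). exists z. split.
      * split; auto. intros k. exists (s k). auto.
      * intros k. now apply itinerary_eq.
    + intros x [_ Hx] k. apply itinerary_eq.
      rewrite <- (Z.mul_1_l (Z.of_nat N)). apply follows_shift.
      now apply follows_itinerary.
Qed.

End Horseshoe.

Lemma loops_horseshoe x0 r0 r1 tau eps :
  L_shadowing d f finv -> r0 <> r1 -> tau < eps -> 0 <= tau ->
  (forall delta, 0 < delta -> loops_through x0 r0 r1 tau delta) ->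
  has_semi_horseshoe x0 eps.
Proof.
  intros HL Hr Hte Ht Hloop.
  destruct (chain_recurrent_close HL) as (rho0 & Hrho0 & Hclose).
  pose proof (dist_pos r0 r1 Hr) as Hpos.
  (* The three bounds keep shadowing points in the class, give [2 * rho + tau <= eps] for the
     diameter, and give [2 * rho < d r0 r1] for the separation. *)
  set (rho := Rmin rho0 (Rmin ((eps - tau) / 2) (d r0 r1 / 3))).
  assert (Hrho : 0 < rho) by (repeat apply Rmin_glb_lt; lra).
  assert (Hrho1 : rho <= rho0) by apply Rmin_l.
  assert (Hrho2 : rho <= Rmin ((eps - tau) / 2) (d r0 r1 / 3)) by apply Rmin_r.
  pose proof (Rmin_l ((eps - tau) / 2) (d r0 r1 / 3)).
  pose proof (Rmin_r ((eps - tau) / 2) (d r0 r1 / 3)).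
  destruct (L_shadowing_shadowing HL rho Hrho) as (delta & Hdl & Hsh).
  destruct (Hloop delta Hdl) as (q & Hq & H1 & H2).
  destruct (clos_trans_fun_through _ _ _ _ H1 H2) as (N & m & P & Hm & HP0 & HPm & HPN & HP).
  destruct (horseshoe_spec x0 q N m
    (fun (b : bool) i => if b then fst (P i) else snd (P i)) rho delta rho0 tau)
    as (M & K & HM & HKL & HKc & HKi & HKd & HKs); auto.
  - lia.
  - intros [|]; now rewrite HP0.
  - intros [|]; now rewrite HPN.
  - intros [|] i Hi; apply HP; auto.
  (* The initial pair is [(q, q)], at distance zero; each later pair is the target of a [jump2]. *)
  - intros [|i] Hi.
    + rewrite HP0. simpl. now rewrite dist_refl.
    + apply (HP i). lia.
  - rewrite HPm. simpl. lra.
  - exists M, K. repeat (split; auto). intros k a b Ha Hb.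
    apply Rle_trans with (2 * rho + tau); auto. lra.
Qed.

(** * Loops in a non-expansive class *)

(** The base point of the loops is [u]. The bound [2 * eps] adds the accuracy of the bracket to the
    tube width, which is at most [eps]. *)
Lemma returning_pair_loops x0 x y u v eps delta1 delta :
  (forall x y, d x y <= delta1 -> exists z, bracket eps x y z) ->
  0 < eps -> 0 < delta -> chain_equiv x0 x ->
  (forall k, d (F k x) (F k y) <= Rmin delta1 eps) -> returns x y u v ->
  loops_through x0 u v (2 * eps) delta.
Proof.
  intros Hbr He Hdl Hx Htube Hret.
  set (c := Rmin delta1 eps) in *.
  assert (Hc1 : c <= delta1) by apply Rmin_l. assert (Hc2 : c <= eps) by apply Rmin_r.
  (* The tube bound on [(x, y)] passes to the limit pair [(u, v)]; each coordinate may use half of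
     the excess [g]. *)
  assert (Huv : forall k, d (F k u) (F k v) <= c).
  { intros k. apply Rnot_lt_le. intros Hlt.
    set (g := d (F k u) (F k v) - c).
    destruct (iterZ_continuous k u (g / 2)) as (r1 & Hr1 & C1); [unfold g; lra|].
    destruct (iterZ_continuous k v (g / 2)) as (r2 & Hr2 & C2); [unfold g; lra|].
    destruct (Hret (Rmin r1 r2) ltac:(now apply Rmin_glb_lt) 0%Z)
      as (i & _ & _ & H1 & H2 & _).
    pose proof (Rmin_l r1 r2). pose proof (Rmin_r r1 r2).
    specialize (C1 (F i x) ltac:(lra)). specialize (C2 (F i y) ltac:(lra)).
    rewrite <- iterZ_add in C1, C2. specialize (Htube (k + i)%Z).
    pose proof (dist_tri (F k u) (F (k + i) x) (F k v)).
    pose proof (dist_tri (F (k + i) x) (F (k + i) y) (F k v)).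
    rewrite (dist_sym (F (k + i) y) (F k v)) in *. unfold g in *. lra. }
  assert (Hu : chain_equiv x0 u).
  { apply chain_equiv_closed. intros r Hr.
    destruct (Hret r Hr 0%Z) as (i & _ & _ & H1 & _).
    exists (F i x). split; auto. now apply chain_equiv_iterZ. }
  pose proof (Huv 0%Z) as Huv0. simpl in Huv0.
  destruct (Hbr u v ltac:(lra)) as (z & Hz1 & Hz2 & Hz).
  destruct (Hbr v u ltac:(rewrite dist_sym; lra)) as (w & Hw1 & Hw2 & Hw).
  destruct (Hz delta Hdl) as (m & Hm & Hzm1 & Hzm2).
  destruct (Hw delta Hdl) as (n & Hn & Hwn1 & Hwn2).
  assert (Hback : forall a b, clos_trans (jump2 delta (2 * eps))
    (F a u, F a v) (F b u, F b v)).
  { intros a b. apply clos_trans_return with x y; auto.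
    - intros k. specialize (Htube k). lra.
    - specialize (Huv b). lra. }
  assert (Hdiag : forall a b, clos_trans (jump2 delta (2 * eps))
    (F a u, F a u) (F b u, F b u)).
  { intros a b. apply clos_trans_return with x x; auto; intros; rewrite ?dist_refl; try lra.
    now apply returns_diag with y v. }
  assert (Hzu : forall k, d (F k u) (F k z) <= 2 * eps).
  { intros k. rewrite dist_sym. destruct (Z.lt_ge_cases k 0) as [Hk|Hk].
    - specialize (Hz1 k Hk). lra.
    - specialize (Hz2 k Hk). specialize (Huv k). rewrite dist_sym in Huv.
      pose proof (dist_tri (F k z) (F k v) (F k u)). lra. }
  assert (Hwu : forall k, d (F k u) (F k w) <= 2 * eps).
  { intros k. rewrite dist_sym. destruct (Z.lt_ge_cases k 0) as [Hk|Hk].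
    - specialize (Hw1 k Hk). specialize (Huv k). rewrite dist_sym in Huv.
      pose proof (dist_tri (F k w) (F k v) (F k u)). lra.
    - specialize (Hw2 k Hk). lra. }
  exists u. split; auto. split.
  (* Go back along the diagonal to the past of [u], let the second coordinate cross along [z] to the
     future of [v], and return to [(u, v)]. The other half crosses back along [w]. *)
  - apply t_trans with (F (- m - 1) u, F (- m - 1) u); [apply (Hdiag 0%Z)|].
    apply t_trans with (F m u, F m v); [|apply (Hback _ 0%Z)].
    apply clos_trans_bracket with z; auto. specialize (Huv m). lra.
  - apply t_trans with (F (- n - 1) u, F (- n - 1) v); [apply (Hback 0%Z)|].
    apply t_trans with (F n u, F n u); [|apply (Hdiag _ 0%Z)].
    apply clos_trans_bracket with w; auto. rewrite dist_refl. lra.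
Qed.

Lemma doubly_proximal_pair_loops x0 x y tau delta :
  0 < delta -> chain_equiv x0 x -> (forall k, d (F k x) (F k y) <= tau) ->
  (exists m, (0 < m)%Z /\ d (F m x) (F m y) < delta) ->
  (exists m, (0 < m)%Z /\ d (F (- m) x) (F (- m) y) < delta) ->
  loops_through x0 x y tau delta.
Proof.
  intros Hdl Hx Ht (m & Hm & Hmd) (n & Hn & Hnd).
  assert (Hseq : forall i j, (i < j)%Z ->
    clos_trans (jump2 delta tau) (F i x, F i y) (F j x, F j y)).
  { intros i j Hij. apply (clos_trans_seq _ (fun k => (F k x, F k y))); auto.
    intros k _. unfold jump2; simpl. auto using iterZ_jump. }
  assert (Ht0 : 0 <= tau) by (specialize (Ht 0%Z); pose proof (dist_ge0 (F 0 x) (F 0 y)); lra).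
  assert (Hend : jump2 delta tau (F (m - 1) x, F (m - 1) y) (F m x, F m x)).
  { unfold jump2, jump; simpl. rewrite <- !iterZ_succ.
    replace (m - 1 + 1)%Z with m by lia.
    rewrite dist_refl, dist_sym. auto. }
  exists (F (- n - 1) x). split; [now apply chain_equiv_iterZ|]. split.
  - apply t_trans with (F (- n) x, F (- n) y); [|apply (Hseq _ 0%Z); lia].
    apply t_step. unfold jump2, jump; simpl. rewrite <- !iterZ_succ.
    replace (- n - 1 + 1)%Z with (- n)%Z by lia. rewrite dist_refl. auto.
  - apply t_trans with (F m x, F m x).
    (* For [m = 1] the closing jump starts at [(x, y)] itself, and there is no orbit segment before
       it. *)
    + destruct (Z.eq_dec m 1) as [->|]; [now apply t_step|].
      apply t_trans with (F (m - 1) x, F (m - 1) y); [apply (Hseq 0%Z); lia|].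
      now apply t_step.
    + apply clos_trans_diag; auto.
      apply (chain_equiv_trans (F m x) x0 (F (- n - 1) x)); auto using chain_equiv_iterZ.
      apply chain_equiv_sym. now apply chain_equiv_iterZ.
Qed.

Lemma returns_of_accumulation x y u v (sg : Z) :
  (sg = 1 \/ sg = -1)%Z ->
  (forall r, 0 < r -> forall n0, exists n, (n0 <= n)%nat /\
    d (F (sg * Z.of_nat n) x) u < r /\ d (F (sg * Z.of_nat n) y) v < r) ->
  returns x y u v.
Proof.
  intros Hsg H r Hr K. destruct (H r Hr 0%nat) as (n1 & _ & H1 & H2).
  destruct (H r Hr (n1 + Z.to_nat K)%nat) as (n2 & Hn & H3 & H4).
  rewrite dist_sym in H1, H2, H3, H4. destruct Hsg as [-> | ->].
  - exists (1 * Z.of_nat n1)%Z, (1 * Z.of_nat n2)%Z. repeat split; auto. lia.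
  (* In the past the larger index is the earlier time, so the two visits exchange roles. *)
  - exists (-1 * Z.of_nat n2)%Z, (-1 * Z.of_nat n1)%Z. repeat split; auto. lia.
Qed.

(** A limit pair of the orbit of [(x, y)] in the direction [sg] lies either on the diagonal, which
    gives proximality, or off it, which gives a returning pair. *)
Lemma proximal_or_returns x y (sg : Z) :
  (sg = 1 \/ sg = -1)%Z ->
  (forall r, 0 < r -> exists m, (0 < m)%Z /\ d (F (sg * m) x) (F (sg * m) y) < r) \/
  exists u v, u <> v /\ returns x y u v.
Proof.
  intros Hsg.
  destruct (cluster_pair_exists (fun n => F (sg * Z.of_nat n) x)
    (fun n => F (sg * Z.of_nat n) y)) as (u & v & H).
  destruct (classic (u = v)) as [<-|Huv].
  - left. intros r Hr. destruct (H (r / 2) ltac:(lra) 1%nat) as (n & Hn & H1 & H2).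
    exists (Z.of_nat n). split; [lia|].
    pose proof (dist_tri (F (sg * Z.of_nat n) x) u (F (sg * Z.of_nat n) y)).
    rewrite (dist_sym u) in *. lra.
  - right. exists u, v. split; auto. now apply returns_of_accumulation with sg.
Qed.

Lemma expansive_or_horseshoes L :
  L_shadowing d f finv -> is_CR_class d f L ->
  expansive_set d f finv L \/ small_semi_horseshoes d f finv L.
Proof.
  intros HL (x0 & Hx0 & HLx0).
  destruct (classic (expansive_set d f finv L)) as [|Hne]; [now left|right].
  intros eps He.
  (* With scale [eps / 4] the loops stay within [eps / 2] of each other, which leaves room for the
     shadowing error. *)
  destruct (L_shadowing_bracket (eps / 4) HL ltac:(lra)) as (delta1 & Hd1 & Hbr).
  set (c := Rmin delta1 (eps / 4)).
  assert (Hc : 0 < c) by (apply Rmin_glb_lt; lra).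
  assert (Hc2 : c <= eps / 4) by apply Rmin_r.
  (* Such a pair exists because [c] is not an expansivity constant of [L]. *)
  assert (Hpair : exists x y, L x /\ x <> y /\ forall k, d (F k x) (F k y) <= c).
  { apply NNPP. intros Hno. apply Hne. exists c; split; auto.
    intros x y Hx _ Hxy. apply NNPP. intros Hn. apply Hno. exists x, y.
    repeat split; auto. intros k. apply Rnot_lt_le. intros Hlt. apply Hn. now exists k. }
  destruct Hpair as (x & y & Hx & Hxy & Ht).
  assert (Hx0x : chain_equiv x0 x) by (apply CR_of_iff; now apply HLx0).
  assert (Hloops : exists r0 r1, r0 <> r1 /\
    forall delta, 0 < delta -> loops_through x0 r0 r1 (2 * (eps / 4)) delta).
  { assert (Hret : (exists u v, u <> v /\ returns x y u v) ->
      exists r0 r1, r0 <> r1 /\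
      forall delta, 0 < delta -> loops_through x0 r0 r1 (2 * (eps / 4)) delta).
    { intros (u & v & Huv & Hr). exists u, v. split; auto. intros delta Hdl.
      apply returning_pair_loops with x y delta1; auto. lra. }
    destruct (proximal_or_returns x y 1) as [Hp|Hr]; auto.
    destruct (proximal_or_returns x y (-1)) as [Hm|Hr]; auto.
    exists x, y. split; auto. intros delta Hdl.
    apply doubly_proximal_pair_loops; [auto|auto| | |exact (Hm delta Hdl)].
    - intros k. specialize (Ht k). lra.
    - destruct (Hp delta Hdl) as (m & Hm0 & Hm1). exists m. now rewrite Z.mul_1_l in Hm1. }
  destruct Hloops as (r0 & r1 & Hr & Hloops).
  destruct (loops_horseshoe x0 r0 r1 (2 * (eps / 4)) eps HL Hr ltac:(lra) ltac:(lra) Hloops)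
    as (M & K & HM & HKL & HK).
  exists M, K. split; auto. split; auto.
  intros z Hz. apply HLx0, CR_of_iff. auto.
Qed.

End Dynamics.

Theorem theoremB (X : Type) (d : X -> X -> R) (f finv : X -> X)
  (Hd : is_metric d) (HX : compact_set d (fun _ => True))
  (Hf : homeomorphism d f finv)
  (HL : L_shadowing d f finv) :
  shadowing d f finv /\
  finitely_many_CR_classes d f /\
  (forall L, is_CR_class d f L ->
     expansive_set d f finv L \/ small_semi_horseshoes d f finv L).
Proof.
  split; [|split].
  - now apply L_shadowing_shadowing.
  - now apply finitely_many_classes with finv.
  - intros L HLc. now apply expansive_or_horseshoes.
Qed.
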